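(* Let $E$ be a graph and let $R$ be a commutative ring with unit. Then $\operatorname{char} L_R(E) = \operatorname{char} R$.
   Context: Graphs: a graph is a directed graph $E=(E^0,E^1,r,s)$ consisting of a countable set $E^0$ (vertices), a countable set $E^1$ (edges) and maps $r,s:E^1\to E^0$ (range, source). A vertex $v$ is regular, $v\in E^0_{\mathrm{reg}}$, if $0<|s^{-1}(v)|<\infty$. Algebras are not assumed commutative or unital. For $R$ a commutative ring with unit $1$, an $R$-algebra is an abelian group $A$ that is both a ring and a left $R$-module with $\lambda(xy)=(\lambda x)y=x(\lambda y)$ and $1\cdot x=x$ for all $\lambda\in R$, $x,y\in A$; homomorphisms of $R$-algebras are $R$-linear ring homomorphisms. A Leavitt $E$-family in a ring is a collection $\{v,e,e^*:v\in E^0,e\in E^1\}$ of elements such that the $v$'s are pairwise orthogonal idempotents and: (1) $s(e)e=er(e)=e$ for all $e\in E^1$; (2) $r(e)e^*=e^*s(e)=e^*$ for all $e\in E^1$; (3) $e^*f=\delta_{e,f}\,r(e)$ for all $e,f\in E^1$; (4) $v=\sum_{s(e)=v}ee^*$ for every $v\in E^0_{\mathrm{reg}}$. The Leavitt path algebra $L_R(E)$ with coefficients in $R$ is the universal $R$-algebra generated by a Leavitt $E$-family $\{v,e,e^*\}$: for every Leavitt $E$-family $\{a_v,b_e,c_{e^*}\}$ in an $R$-algebra $A$ there is an $R$-algebra homomorphism $L_R(E)\to A$ with $v\mapsto a_v$, $e\mapsto b_e$, $e^*\mapsto c_{e^*}$. The characteristic $\operatorname{char} T$ of a ring $T$ is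 the smallest positive integer $n$ such that $nx=0$ for all $x\in T$, if such an $n$ exists, and $0$ otherwise.
   Formalization: The graph E is assumed to have at least one vertex; for the empty graph the Leavitt path algebra is zero and has characteristic 1, so the equality fails unless R is the zero ring. *)

(* Defs.v *)
From HB Require Import structures.
From mathcomp Require Import all_boot all_order all_algebra finmap.
From mathcomp Require Import boolp classical_sets functions cardinality fsbigop.

Set Implicit Arguments.
Unset Strict Implicit.
Unset Printing Implicit Defensive.

Import GRing.Theory.
Local Open Scope classical_set_scope.
Local Open Scope ring_scope.

(* MathComp rings and algebras are unital; algebras here need not be, and
   Leavitt path algebras of graphs with infinitely many vertices are not. *)
HB.mixin Record Lmodule_isNuAlgebra (R : comPzRingType) A
    of GRing.Lmodule R A := {
  numul : A -> A -> A;
  numulA : associative numul;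
  numulDl : left_distributive numul +%R;
  numulDr : right_distributive numul +%R;
  nuscaleAl : forall (k : R) (x y : A), k *: numul x y = numul (k *: x) y;
  nuscaleAr : forall (k : R) (x y : A), k *: numul x y = numul x (k *: y)
}.

#[short(type="nuAlgType")]
HB.structure Definition NuAlgebra (R : comPzRingType) :=
  {A of GRing.Lmodule R A & Lmodule_isNuAlgebra R A}.

Infix "**" := numul (at level 40, left associativity) : ring_scope.

(* The multiplication plays no role: only the additive group matters.  The
   trivial ring has characteristic 1, and so does the Leavitt path algebra of
   the empty graph. *)
Definition annihilates (T : zmodType) (n : nat) : Prop :=
  (0 < n)%N /\ forall x : T, x *+ n = 0.

Definition characteristic (T : zmodType) : nat :=
  if pselect (exists n, `[< annihilates T n >]) is left ex then ex_minn ex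
  else 0%N.

Record graph := Graph {
  vertex : countType;
  edge : countType;
  edge_range : edge -> vertex;
  edge_source : edge -> vertex
}.

Definition emitted (E : graph) (v : vertex E) : set (edge E) :=
  [set e | edge_source e = v].

Definition regular_vertex (E : graph) (v : vertex E) : Prop :=
  emitted v !=set0 /\ finite_set (emitted v).

(* [a v], [b e] and [c e] stand for the elements v, e and e^* of the family. *)
Record leavitt_family (R : comPzRingType) (E : graph) (A : nuAlgType R)
    (a : vertex E -> A) (b c : edge E -> A) : Prop := LeavittFamily {
  lf_vertex : forall v w, a v ** a w = if v == w then a v else 0;
  lf_source : forall e, a (edge_source e) ** b e = b e;
  lf_range : forall e, b e ** a (edge_range e) = b e;
  lf_range_ghost : forall e, a (edge_range e) ** c e = c e;
  lf_source_ghost : forall e, c e ** a (edge_source e) = c e;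
  lf_CK1 : forall e f, c e ** b f = if e == f then a (edge_range e) else 0;
  lf_CK2 : forall v, regular_vertex v -> a v = \sum_(e \in emitted v) (b e ** c e)
}.

Record subalgebra (R : comPzRingType) (A : nuAlgType R) (S : set A) : Prop :=
  Subalgebra {
  subalg0 : S 0;
  subalgD : forall x y, S x -> S y -> S (x + y);
  subalgZ : forall (k : R) x, S x -> S (k *: x);
  subalgM : forall x y, S x -> S y -> S (x ** y)
}.

Record is_leavitt_path_algebra (R : comPzRingType) (E : graph)
    (L : nuAlgType R) (p : vertex E -> L) (q q' : edge E -> L) : Prop :=
  IsLeavittPathAlgebra {
  lpa_family : leavitt_family p q q';
  lpa_generated : forall S : set L, subalgebra S ->
    (forall v, S (p v)) -> (forall e, S (q e)) -> (forall e, S (q' e)) ->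
    forall x, S x;
  lpa_universal : forall (A : nuAlgType R) (a : vertex E -> A)
      (b c : edge E -> A), leavitt_family a b c ->
    exists f : {linear L -> A},
      [/\ forall x y, f (x ** y) = f x ** f y,
          forall v, f (p v) = a v,
          forall e, f (q e) = b e
        & forall e, f (q' e) = c e]
}.

(* Existence of the Leavitt path algebra: formal expressions in the
   generators, modulo the congruence generated by the algebra axioms and the
   relations of a Leavitt family. *)
Section Existence.
Variables (R : comPzRingType) (E : graph).

Inductive term : Type :=
| TVertex of vertex E
| TEdge of edge E
| TGhost of edge E
| TZero
| TOpp of term
| TAdd of term & term
| TScale of R & term
| TMul of term & term.

HB.instance Definition _ := gen_eqMixin term.
HB.instance Definition _ := gen_choiceMixin term.

Definition tsum (s : seq term) : term := foldr TAdd TZero s.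

Inductive cong : term -> term -> Prop :=
| cong_refl x : cong x x
| cong_sym x y : cong x y -> cong y x
| cong_trans x y z : cong x y -> cong y z -> cong x z
| cong_opp x y : cong x y -> cong (TOpp x) (TOpp y)
| cong_add x x' y y' : cong x x' -> cong y y' -> cong (TAdd x y) (TAdd x' y')
| cong_scale k x y : cong x y -> cong (TScale k x) (TScale k y)
| cong_mul x x' y y' : cong x x' -> cong y y' -> cong (TMul x y) (TMul x' y')
| cong_addA x y z : cong (TAdd x (TAdd y z)) (TAdd (TAdd x y) z)
| cong_addC x y : cong (TAdd x y) (TAdd y x)
| cong_add0 x : cong (TAdd TZero x) x
| cong_addN x : cong (TAdd (TOpp x) x) TZero
| cong_scaleA k l x : cong (TScale k (TScale l x)) (TScale (k * l) x)
| cong_scale1 x : cong (TScale 1 x) x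
| cong_scaleDr k x y :
    cong (TScale k (TAdd x y)) (TAdd (TScale k x) (TScale k y))
| cong_scaleDl k l x :
    cong (TScale (k + l) x) (TAdd (TScale k x) (TScale l x))
| cong_mulA x y z : cong (TMul x (TMul y z)) (TMul (TMul x y) z)
| cong_mulDl x y z : cong (TMul (TAdd x y) z) (TAdd (TMul x z) (TMul y z))
| cong_mulDr x y z : cong (TMul x (TAdd y z)) (TAdd (TMul x y) (TMul x z))
| cong_scaleAl k x y : cong (TScale k (TMul x y)) (TMul (TScale k x) y)
| cong_scaleAr k x y : cong (TScale k (TMul x y)) (TMul x (TScale k y))
| cong_vertex v w : cong (TMul (TVertex v) (TVertex w))
    (if v == w then TVertex v else TZero)
| cong_source e : cong (TMul (TVertex (edge_source e)) (TEdge e)) (TEdge e)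
| cong_range e : cong (TMul (TEdge e) (TVertex (edge_range e))) (TEdge e)
| cong_range_ghost e :
    cong (TMul (TVertex (edge_range e)) (TGhost e)) (TGhost e)
| cong_source_ghost e :
    cong (TMul (TGhost e) (TVertex (edge_source e))) (TGhost e)
| cong_CK1 e f : cong (TMul (TGhost e) (TEdge f))
    (if e == f then TVertex (edge_range e) else TZero)
| cong_CK2 v : regular_vertex v -> cong (TVertex v)
    (tsum [seq TMul (TEdge e) (TGhost e) | e <- fset_set (emitted v)]).

Definition congb (x y : term) : bool := `[< cong x y >].

Lemma congb_equiv : equiv_class_of congb.
Proof.
split=> [x|x y|y x z]; rewrite /congb.
- by apply/asboolP; apply: cong_refl.
- by apply/asboolP/asboolP; apply: cong_sym.
- by move=> /asboolP xy /asboolP yz; apply/asboolP; apply: cong_trans xy yz.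
Qed.

Canonical cong_equivRel := EquivRelPack congb_equiv.

Local Open Scope quotient_scope.

Definition lpa := {eq_quot cong_equivRel}.
HB.instance Definition _ := Choice.on lpa.

Let pi_lpa (x : term) : lpa := \pi x.

Let pi_eq x y : cong x y -> pi_lpa x = pi_lpa y.
Proof. by move=> xy; apply/eqmodP; apply/asboolP. Qed.

Let repr_pi x : cong (repr (pi_lpa x)) x.
Proof. by apply/asboolP; apply/(@eqmodP _ cong_equivRel); rewrite reprK. Qed.

Let pi_repr (x : lpa) : pi_lpa (repr x) = x. Proof. exact: reprK. Qed.

Let zero := pi_lpa TZero.
Let opp (x : lpa) := pi_lpa (TOpp (repr x)).
Let add (x y : lpa) := pi_lpa (TAdd (repr x) (repr y)).
Let scale k (x : lpa) := pi_lpa (TScale k (repr x)).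
Let mul (x y : lpa) := pi_lpa (TMul (repr x) (repr y)).

Let oppE x : opp (pi_lpa x) = pi_lpa (TOpp x).
Proof. exact/pi_eq/cong_opp. Qed.
Let addE x y : add (pi_lpa x) (pi_lpa y) = pi_lpa (TAdd x y).
Proof. exact/pi_eq/cong_add. Qed.
Let scaleE k x : scale k (pi_lpa x) = pi_lpa (TScale k x).
Proof. exact/pi_eq/cong_scale. Qed.
Let mulE x y : mul (pi_lpa x) (pi_lpa y) = pi_lpa (TMul x y).
Proof. exact/pi_eq/cong_mul. Qed.

Let lpaW (P : lpa -> Prop) : (forall x, P (pi_lpa x)) -> forall x, P x.
Proof. by move=> H x; rewrite -(pi_repr x). Qed.

Let addA : associative add.
Proof.
by elim/lpaW=> x; elim/lpaW=> y; elim/lpaW=> z; rewrite !addE; apply/pi_eq/cong_addA.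
Qed.
Let addC : commutative add.
Proof. by elim/lpaW=> x; elim/lpaW=> y; rewrite !addE; apply/pi_eq/cong_addC. Qed.
Let add0 : left_id zero add.
Proof. by elim/lpaW=> x; rewrite addE; apply/pi_eq/cong_add0. Qed.
Let addN : left_inverse zero opp add.
Proof. by elim/lpaW=> x; rewrite oppE addE; apply/pi_eq/cong_addN. Qed.

HB.instance Definition _ := GRing.isZmodule.Build lpa addA addC add0 addN.

Let piD x y : pi_lpa (TAdd x y) = pi_lpa x + pi_lpa y.
Proof. exact/esym/addE. Qed.

Let scaleA k l (x : lpa) : scale k (scale l x) = scale (k * l) x.
Proof. by elim/lpaW: x => x; rewrite !scaleE; apply/pi_eq/cong_scaleA. Qed.
Let scale1 : left_id 1 scale.
Proof. by elim/lpaW=> x; rewrite scaleE; apply/pi_eq/cong_scale1. Qed.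
Let scaleDr : right_distributive scale +%R.
Proof.
move=> k; elim/lpaW=> x; elim/lpaW=> y.
by rewrite -piD !scaleE -piD; apply/pi_eq/cong_scaleDr.
Qed.
Let scaleDl (x : lpa) : {morph scale^~ x : k l / k + l}.
Proof.
move=> k l; elim/lpaW: x => x.
by rewrite !scaleE -piD; apply/pi_eq/cong_scaleDl.
Qed.

HB.instance Definition _ :=
  GRing.Zmodule_isLmodule.Build R lpa scaleA scale1 scaleDr scaleDl.

Let mulA : associative mul.
Proof.
by elim/lpaW=> x; elim/lpaW=> y; elim/lpaW=> z; rewrite !mulE; apply/pi_eq/cong_mulA.
Qed.
Let mulDl : left_distributive mul +%R.
Proof.
elim/lpaW=> x; elim/lpaW=> y; elim/lpaW=> z.
by rewrite -piD !mulE -piD; apply/pi_eq/cong_mulDl.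
Qed.
Let mulDr : right_distributive mul +%R.
Proof.
elim/lpaW=> x; elim/lpaW=> y; elim/lpaW=> z.
by rewrite -piD !mulE -piD; apply/pi_eq/cong_mulDr.
Qed.
Let scaleAl (k : R) (x y : lpa) : k *: mul x y = mul (k *: x) y.
Proof.
elim/lpaW: x => x; elim/lpaW: y => y.
by rewrite /GRing.scale /= !(scaleE, mulE); apply/pi_eq/cong_scaleAl.
Qed.
Let scaleAr (k : R) (x y : lpa) : k *: mul x y = mul x (k *: y).
Proof.
elim/lpaW: x => x; elim/lpaW: y => y.
by rewrite /GRing.scale /= !(scaleE, mulE); apply/pi_eq/cong_scaleAr.
Qed.

HB.instance Definition _ :=
  Lmodule_isNuAlgebra.Build R lpa mulA mulDl mulDr scaleAl scaleAr.

Definition lpa_vertex (v : vertex E) : lpa := pi_lpa (TVertex v).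
Definition lpa_edge (e : edge E) : lpa := pi_lpa (TEdge e).
Definition lpa_ghost (e : edge E) : lpa := pi_lpa (TGhost e).

Let pi0 : pi_lpa TZero = 0. Proof. by []. Qed.
Let piN x : pi_lpa (TOpp x) = - pi_lpa x. Proof. exact/esym/oppE. Qed.
Let piZ k x : pi_lpa (TScale k x) = k *: pi_lpa x.
Proof. exact/esym/scaleE. Qed.
Let piM x y : pi_lpa (TMul x y) = pi_lpa x ** pi_lpa y.
Proof. exact/esym/mulE. Qed.
Let pi_sum (I : Type) (s : seq I) (F : I -> term) :
  pi_lpa (tsum [seq F i | i <- s]) = \sum_(i <- s) pi_lpa (F i).
Proof. by elim: s => [|i s IH]; rewrite ?big_nil //= big_cons piD IH. Qed.

Lemma lpa_leavitt_family : leavitt_family lpa_vertex lpa_edge lpa_ghost.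
Proof.
split=> [v w|e|e|e|e|e f|v v_reg]; rewrite /lpa_vertex /lpa_edge /lpa_ghost
  -?piM.
- rewrite (pi_eq (cong_vertex v w)); by case: ifP.
- exact/pi_eq/cong_source.
- exact/pi_eq/cong_range.
- exact/pi_eq/cong_range_ghost.
- exact/pi_eq/cong_source_ghost.
- rewrite (pi_eq (cong_CK1 e f)); by case: ifP.
- rewrite (pi_eq (cong_CK2 v_reg)) pi_sum fsbig_finite; last by case: v_reg.
  by apply: eq_bigr => e _; rewrite piM.
Qed.

Section Eval.
Variables (A : nuAlgType R) (a : vertex E -> A) (b c : edge E -> A).
Hypothesis abc : leavitt_family a b c.

Fixpoint eval (x : term) : A :=
  match x with
  | TVertex v => a v
  | TEdge e => b e
  | TGhost e => c e
  | TZero => 0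
  | TOpp x => - eval x
  | TAdd x y => eval x + eval y
  | TScale k x => k *: eval x
  | TMul x y => eval x ** eval y
  end.

Lemma eval_sum (I : Type) (s : seq I) (F : I -> term) :
  eval (tsum [seq F i | i <- s]) = \sum_(i <- s) eval (F i).
Proof. by elim: s => [|i s IH]; rewrite ?big_nil //= big_cons IH. Qed.

Lemma eval_cong x y : cong x y -> eval x = eval y.
Proof.
elim=> {x y} //=.
- by move=> x y z _ -> _ ->.
- by move=> x y _ ->.
- by move=> x x' y y' _ -> _ ->.
- by move=> k x y _ ->.
- by move=> x x' y y' _ -> _ ->.
- by move=> *; rewrite addrA.
- by move=> *; rewrite addrC.
- by move=> *; rewrite add0r.
- by move=> *; rewrite addNr.
- by move=> *; rewrite scalerA.
- by move=> *; rewrite scale1r.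
- by move=> *; rewrite scalerDr.
- by move=> *; rewrite scalerDl.
- by move=> *; rewrite numulA.
- by move=> *; rewrite numulDl.
- by move=> *; rewrite numulDr.
- by move=> *; rewrite nuscaleAl.
- by move=> *; rewrite nuscaleAr.
- by move=> v w; rewrite (lf_vertex abc); case: ifP.
- exact: lf_source abc.
- exact: lf_range abc.
- exact: lf_range_ghost abc.
- exact: lf_source_ghost abc.
- by move=> e f; rewrite (lf_CK1 abc); case: ifP.
- move=> v v_reg; rewrite (lf_CK2 abc v_reg) eval_sum fsbig_finite //.
  by case: v_reg.
Qed.

Definition lpa_hom (x : lpa) : A := eval (repr x).

Lemma lpa_homE x : lpa_hom (pi_lpa x) = eval x.
Proof. exact/eval_cong/repr_pi. Qed.

Lemma lpa_hom_linear : linear lpa_hom.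
Proof.
move=> k; elim/lpaW=> x; elim/lpaW=> y.
by rewrite -piZ -piD !lpa_homE.
Qed.

HB.instance Definition _ :=
  GRing.isLinear.Build R lpa A _ lpa_hom lpa_hom_linear.

Lemma lpa_hom_exists : exists f : {linear lpa -> A},
  [/\ forall x y, f (x ** y) = f x ** f y,
      forall v, f (lpa_vertex v) = a v,
      forall e, f (lpa_edge e) = b e
    & forall e, f (lpa_ghost e) = c e].
Proof.
exists lpa_hom; split=> [|v|e|e] /=; rewrite ?lpa_homE //.
by elim/lpaW=> x; elim/lpaW=> y; rewrite -piM !lpa_homE.
Qed.

End Eval.

Theorem leavitt_path_algebra_exists :
  exists (L : nuAlgType R) (p : vertex E -> L) (q q' : edge E -> L),
    is_leavitt_path_algebra p q q'.
Proof.
exists lpa, lpa_vertex, lpa_edge, lpa_ghost; split.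
- exact: lpa_leavitt_family.
- move=> S [S0 SD SZ SM] Sv Se Sg; elim/lpaW.
  elim=> [v|e|e||x Sx|x Sx y Sy|k x Sx|x Sx y Sy].
  + exact: Sv.
  + exact: Se.
  + exact: Sg.
  + exact: S0.
  + by rewrite piN -scaleN1r; apply: SZ.
  + by rewrite piD; apply: SD.
  + by rewrite piZ; apply: SZ.
  + by rewrite piM; apply: SM.
- move=> A a b c abc; exact: lpa_hom_exists abc.
Qed.

End Existence.

(* Main.v *)
From HB Require Import structures.
Require Import Defs.
From mathcomp Require Import all_boot all_order all_algebra finmap.
From mathcomp Require Import boolp classical_sets functions cardinality fsbigop.

(** The two characteristics agree because [L] and [R] are killed by the same
    integers.  If [n] kills [R], then [x *+ n = n%:R *: x] vanishes for every
    [x] in [L].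

    For the converse, it is enough that [p v *+ n = 0] forces [n%:R = 0] in
    [R] for a vertex [v].  By the universal property this can be checked on
    the image of [p v] in any algebra that carries a Leavitt family, so one
    needs a single representation in which the vertices act without torsion
    beyond that of [R].  It comes from a branching system.  Give each vertex
    [v] a copy [{v} * nat] of the natural numbers.  When [v] emits an edge, the
    set of edges it emits is countable and nonempty, so [nat] is in bijection
    with the disjoint union of one copy of [nat] for each emitted edge
    ([emitted_coding]).  An edge [e] thus identifies the copy of [nat] at its
    range with a piece of the copy at its source, the pieces of distinct edges
    are disjoint, and together they fill the copy at every vertex that emits
    something.  On functions from [vertex E * nat] to [R], let vertices act by
    restriction, edges by transport along these identifications, and ghost
    edges by transport backwards: this is a Leavitt family in the algebra of
    endomorphisms ([branching_leavitt_family]), where disjointness gives the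
    first Cuntz-Krieger relation and covering the second.  Evaluating
    [n] times the action of [v] on the constant function 1, at a point above
    [v], returns [n%:R]. *)

Set Implicit Arguments.
Unset Strict Implicit.
Unset Printing Implicit Defensive.
Import GRing.Theory.
Local Open Scope classical_set_scope.
Local Open Scope ring_scope.

Section Endomorphisms.
Variables (R : comPzRingType) (M : lmodType R).

Definition linear_maps : {pred M -> M} := fun f => `[< linear f >].

(** Commutativity of [R] makes the multiples of a linear map linear. *)
Lemma linear_maps_submod : submod_closed linear_maps.
Proof.
split=> [|k f g /asboolP f_lin /asboolP g_lin]; apply/asboolP => l x y.
  by rewrite /= scaler0 addr0.
rewrite !fctE f_lin g_lin !scalerDr !scalerA (mulrC l).
by rewrite -!addrA; congr (_ + _); rewrite addrCA.
Qed.

HB.instance Definition _ :=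
  GRing.isSubmodClosed.Build R (M -> M) linear_maps
    (GRing.submod_closed_semi linear_maps_submod).

Record endo := Endo { endo_fun :> M -> M; _ : endo_fun \in linear_maps }.

HB.instance Definition _ := [isSub for endo_fun].
HB.instance Definition _ := [Choice of endo by <:].
HB.instance Definition _ := [SubChoice_isSubLmodule of endo by <:].

Lemma endo_linear (f : endo) : linear f.
Proof. by apply/asboolP; case: f. Qed.

Lemma comp_linear (f g : endo) : (f \o g : M -> M) \in linear_maps.
Proof. by apply/asboolP => k x y /=; rewrite !endo_linear. Qed.

Definition endo_comp (f g : endo) : endo := Endo (comp_linear f g).

Lemma endoP (f g : endo) : f =1 g -> f = g.
Proof. by move=> /funext fg; apply: val_inj. Qed.

Lemma endoD (f g : endo) x : (f + g) x = f x + g x.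
Proof. by []. Qed.
Lemma endoZ k (f : endo) x : (k *: f) x = k *: f x.
Proof. by []. Qed.

Lemma endo_compE f g x : endo_comp f g x = f (g x).
Proof. by []. Qed.

Lemma endoMn (f : endo) n x : (f *+ n) x = f x *+ n.
Proof. by elim: n => // n IH; rewrite !mulrS endoD IH. Qed.

Lemma endo_compA : associative endo_comp.
Proof. by move=> f g h; apply: endoP. Qed.
Lemma endo_compDl : left_distributive endo_comp +%R.
Proof. by move=> f g h; apply: endoP. Qed.
Lemma endo_compDr : right_distributive endo_comp +%R.
Proof.
move=> f g h; apply: endoP => x; rewrite endoD !endo_compE endoD.
by rewrite -[g x]scale1r endo_linear !scale1r.
Qed.
Lemma endo_scaleAl k (f g : endo) :
  k *: endo_comp f g = endo_comp (k *: f) g.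
Proof. exact: endoP. Qed.
Lemma endo_scaleAr k (f g : endo) :
  k *: endo_comp f g = endo_comp f (k *: g).
Proof.
apply: endoP => x; rewrite endoZ !endo_compE endoZ.
have f0 : f 0 = 0.
  have := endo_linear f 1 0 0.
  by rewrite !scale1r addr0 -{1}[f 0]addr0 => /addrI.
by rewrite -[k *: g x]addr0 endo_linear f0 addr0.
Qed.

HB.instance Definition _ := Lmodule_isNuAlgebra.Build R endo
  endo_compA endo_compDl endo_compDr endo_scaleAl endo_scaleAr.

End Endomorphisms.

Arguments linear_maps {R} M.

(** A nonempty countable union of disjoint copies of [nat] is countably
    infinite, hence in bijection with [nat].  The inverse [k] is partial
    because a sink has no edge to return. *)
Lemma emitted_coding (E : graph) (v : vertex E) :
  exists (f : edge E * nat -> nat) (k : nat -> option (edge E * nat)),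
  [/\ forall x, edge_source x.1 = v -> k (f x) = Some x,
      forall n x, k n = Some x -> edge_source x.1 = v /\ f x = n
    & emitted v !=set0 -> forall n, k n].
Proof.
have [[e0 e0v]|v_sink] := pselect (emitted v !=set0); last first.
  exists (fun=> 0%N), (fun=> None); split=> // x xv.
  by case: v_sink; exists x.1.
have /card_set_bijP[f [_ f_inj f_surj]] :
    (emitted v `*` [set: nat] #= [set: nat])%card.
  apply: eq_card_nat; first exact: countableP.
  apply: (@sub_infinite_set _ (pair e0 @` [set: nat])).
    by move=> _ [m _ <-].
  apply/infiniteP; rewrite (card_le_eqr (inj_card_eq _)) //.
  by move=> m n _ _ [].
have /choice[k kP] n : exists x, (emitted v `*` [set: nat]) x /\ f x = n.
  by have [x Ax fx] := f_surj n I; exists x.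
exists f, (Some \o k); split=> //= [x xv|n x [<-]].
  have [Ak fk] := kP (f x); congr Some.
  by apply: f_inj fk; rewrite inE //; split.
by have [[]] := kP n.
Qed.

(** The point [(v, n)] lies in the piece of the edge [e] when [decode v n] is
    [Some (e, m)]; it then corresponds to the point [(edge_range e, m)]. *)
Section BranchingSystem.
Variables (R : comPzRingType) (E : graph).
Variables (code : vertex E -> edge E * nat -> nat)
  (decode : vertex E -> nat -> option (edge E * nat)).
Hypothesis codeK : forall v x,
  edge_source x.1 = v -> decode v (code v x) = Some x.
Hypothesis decodeP : forall v n x,
  decode v n = Some x -> edge_source x.1 = v /\ code v x = n.
Hypothesis decode_total : forall v, emitted v !=set0 -> forall n, decode v n.

(* [R^o] rather than [R]: functions into [R] inherit a module structure only
   from the regular module. *)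
Local Notation space := (vertex E * nat -> R^o).

Definition vertex_fun v (phi : space) : space :=
  fun z => if z.1 == v then phi z else 0.

Definition edge_fun e (phi : space) : space :=
  fun z => if decode z.1 z.2 is Some (f, m) then
             if f == e then phi (edge_range e, m) else 0
           else 0.

Definition ghost_fun e (phi : space) : space :=
  fun z => if z.1 == edge_range e then
             phi (edge_source e, code (edge_source e) (e, z.2))
           else 0.

Lemma vertex_fun_linear v : vertex_fun v \in linear_maps space.
Proof.
apply/asboolP => k phi psi; apply/funext => z; rewrite /vertex_fun !fctE.
by case: ifP => _ //=; rewrite scaler0 addr0.
Qed.

Lemma edge_fun_linear e : edge_fun e \in linear_maps space.
Proof.
apply/asboolP => k phi psi; apply/funext => z; rewrite /edge_fun !fctE.
by case: decode => [[f m]|]; first case: ifP => _ //=; rewrite scaler0 addr0.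
Qed.

Lemma ghost_fun_linear e : ghost_fun e \in linear_maps space.
Proof.
apply/asboolP => k phi psi; apply/funext => z; rewrite /ghost_fun !fctE.
by case: ifP => _ //=; rewrite scaler0 addr0.
Qed.

Definition vertex_endo v : endo space := Endo (vertex_fun_linear v).
Definition edge_endo e : endo space := Endo (edge_fun_linear e).
Definition ghost_endo e : endo space := Endo (ghost_fun_linear e).

Lemma endo_sum (I : Type) (s : seq I) (F : I -> endo space) phi z :
  (\sum_(i <- s) F i) phi z = \sum_(i <- s) F i phi z.
Proof. by elim/big_rec2: _ => // i y1 y2 _ <-. Qed.

(** The covering property [decode_total] enters only in the last relation: it
    puts every point above [v] in the piece of exactly one emitted edge [e], so
    that the terms of the other edges vanish there and the term of [e] sends
    the point to the range of [e] and back. *)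
Lemma branching_leavitt_family :
  leavitt_family vertex_endo edge_endo ghost_endo.
Proof.
split=> [v w|e|e|e|e|e f|v v_reg].
- apply: endoP => phi; apply/funext => -[u n].
  rewrite /numul /= /vertex_fun /=.
  have [->|vw] := eqVneq v w; first by rewrite /= /vertex_fun /=; case: eqVneq.
  by case: (eqVneq u v) => // ->; rewrite (negPf vw).
- apply: endoP => phi; apply/funext => -[u n].
  rewrite /numul /= /vertex_fun /edge_fun /=.
  case: eqVneq => // ue; case duE: decode => [[f m]|] //.
  have [/= fu _] := decodeP duE; case: eqVneq => // fe.
  by rewrite -fu fe eqxx in ue.
- apply: endoP => phi; apply/funext => -[u n].
  rewrite /numul /= /vertex_fun /edge_fun /=.
  by case: decode => [[f m]|] //=; rewrite eqxx.
- apply: endoP => phi; apply/funext => -[u n].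
  by rewrite /numul /= /vertex_fun /ghost_fun /=; case: eqVneq.
- apply: endoP => phi; apply/funext => -[u n].
  by rewrite /numul /= /vertex_fun /ghost_fun /= eqxx.
- apply: endoP => phi; apply/funext => -[u n].
  rewrite /numul /= /vertex_fun /edge_fun /ghost_fun /= codeK //.
  have [->|] := eqVneq e f => /=; last by case: (eqVneq u).
  by rewrite /vertex_fun /=; case: eqVneq => // ->.
- apply: endoP => phi; apply/funext => -[u n].
  have [v_emits v_fin] := v_reg.
  rewrite fsbig_finite // endo_sum /= /vertex_fun /=.
  rewrite /numul /= /edge_fun /ghost_fun /=.
  case: eqVneq => [->|uv].
    have := decode_total v_emits n; case dE: decode => [[e m]|] // _.
    have [/= ev fE] := decodeP dE.
    rewrite (big_fsetD1 e) /=; last by rewrite in_fset_set // inE.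
    rewrite eqxx eqxx ev fE big1_fset ?addr0 // => f.
    by rewrite !inE eq_sym => /andP[/negPf -> _].
  rewrite big1_fset // => e; rewrite in_fset_set // inE /emitted /= => ev _.
  case dE: decode => [[f m]|] //; case: eqVneq => // fe.
  by have [/= fu _] := decodeP dE; rewrite -fu fe ev eqxx in uv.
Qed.

End BranchingSystem.

(** The constant function 1 detects the torsion of the scalars: restricting it
    to [v] and taking [n] copies leaves the value [n%:R] above [v]. *)
Lemma leavitt_family_vertex_torsion (R : comPzRingType) (E : graph) :
  exists (A : nuAlgType R) (a : vertex E -> A) (b c : edge E -> A),
    leavitt_family a b c /\
    forall v n, a v *+ n = 0 -> n%:R = 0 :> R.
Proof.
have /choice[code] := @emitted_coding E.
move=> /choice[decode cdP].
exists (endo (vertex E * nat -> R^o)).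
exists (@vertex_endo R E), (edge_endo R decode), (ghost_endo R code).
split.
  by apply: branching_leavitt_family => v; have [] := cdP v.
move=> v n vn0.
have : (vertex_endo R v *+ n) (fun=> 1) (v, 0%N) = 0 by rewrite vn0.
suff mulnE (f : vertex E * nat -> R^o) z : (f *+ n) z = f z *+ n.
  by rewrite endoMn mulnE /= /vertex_fun eqxx.
by elim: n {vn0} => // n IH; rewrite !mulrS -IH.
Qed.

Lemma eq_characteristic (S T : zmodType) :
  (forall n, annihilates S n <-> annihilates T n) ->
  characteristic S = characteristic T.
Proof.
move=> ST; have : annihilates S = annihilates T.
  by apply/funext => n; apply/propext.
by rewrite /characteristic => ->.
Qed.

Theorem corollary3p5 (R : comPzRingType) (E : graph)
    (hE : inhabited (vertex E))
    (L : nuAlgType R) (p : vertex E -> L) (q q' : edge E -> L)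
    (hL : is_leavitt_path_algebra p q q') :
  characteristic L = characteristic R.
Proof.
have [v] := hE; apply: eq_characteristic => n.
split=> -[n_gt0 n0]; split=> // x; last first.
  by rewrite -scaler_nat n0 scale0r.
have [A [a [b [c [abc a_torsion]]]]] := leavitt_family_vertex_torsion R E.
have [f [_ fp _ _]] := lpa_universal hL abc.
rewrite -mulr_natl (a_torsion v) ?mul0r //.
by rewrite -fp -raddfMn n0 raddf0.
Qed.
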